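(* Let $k$ be a nonnegative integer and $\varphi=\frac{1+\sqrt5}{2}$. For $0<x<\varphi-1$, $$3\prod_{n=1}^{\infty}(1+x^n)-2\sum_{n=1}^{\infty}\frac{x^n}{1-x^{2n}}<\frac{x^4}{(1-x^2)(1-x^4)}+\frac{1}{x^{k-1}(1+x)^k(1-x-x^2)}-\frac{1}{x^k(1+x)^k}\sum_{n=0}^{2k}\left(F_n-S_{n,k} \right)x^n,$$ where $$S_{n,k}=\sum_{j=0}^{k}\binom{k}{j}\bigl(3q(n-k-j)-2Q_1(n-k-j)-Q_2(n-k-j)\bigr).$$
   Context: $q(n)$ denotes the number of partitions of the positive integer $n$ into odd parts; $q(0)=1$ and $q(n)=0$ for negative $n$. For $n\geq1$, $Q_1(n)$ is the number of odd positive divisors of $n$, and $Q_2(n)$ is the number of partitions of $n$ into two distinct odd parts, i.e. $Q_2(n)=\lfloor n/4\rfloor$ if $n$ is even and $Q_2(n)=0$ if $n$ is odd; $Q_1(n)=Q_2(n)=0$ for $n\leq0$. $F_n$ is the $n$-th Fibonacci number: $F_0=0$, $F_1=1$, $F_n=F_{n-1}+F_{n-2}$. *)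

(* Defs.v *)
From HB Require Import structures.
From mathcomp Require Import all_boot all_order all_algebra zify.
From mathcomp Require Import all_classical all_reals all_analysis.

Set Implicit Arguments.
Unset Strict Implicit.
Unset Printing Implicit Defensive.

Import Order.TTheory GRing.Theory Num.Theory.
Import numFieldNormedType.Exports.

Local Open Scope ring_scope.

(* A partition of n into odd parts is encoded by its multiplicity function:
   m i is the number of occurrences of the part i. Parts and multiplicities
   of a partition of n never exceed n, so bounding both by n loses nothing. *)
Definition odd_partitions (n : nat) : {set {ffun 'I_n.+1 -> 'I_n.+1}} :=
  [set m : {ffun 'I_n.+1 -> 'I_n.+1} |
    [forall i : 'I_n.+1, (0 < m i)%N ==> odd i] &&
    (\sum_(i < n.+1) i * m i == n)%N].

Definition odd_divisors (n : nat) : {set 'I_n.+1} :=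
  [set d : 'I_n.+1 | odd d && (d %| n)%N].

(* The unordered pair of parts is listed in increasing order. *)
Definition two_distinct_odd_parts (n : nat) : {set 'I_n.+1 * 'I_n.+1} :=
  [set p : 'I_n.+1 * 'I_n.+1 |
    [&& odd p.1, odd p.2, (p.1 < p.2)%N & (p.1 + p.2 == n)%N]].

Definition q (n : int) : nat :=
  match n with
  | Posz m => #|odd_partitions m|
  | Negz _ => 0%N
  end.

Definition Q1 (n : int) : nat :=
  match n with
  | Posz m.+1 => #|odd_divisors m.+1|
  | _ => 0%N
  end.

Definition Q2 (n : int) : nat :=
  match n with
  | Posz m.+1 => #|two_distinct_odd_parts m.+1|
  | _ => 0%N
  end.

Lemma q0 : q 0 = 1%N.
Proof.
rewrite -[LHS]/#|odd_partitions 0| (_ : odd_partitions 0 = [set: _]); last first.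
  apply/setP => m; rewrite !inE big_ord1 andbT.
  by apply/forallP => i; case: (m i) => [[|?]].
by rewrite cardsT card_ffun !card_ord.
Qed.

Lemma Q2E (n : nat) : Q2 n%:Z = (if odd n then 0 else n %/ 4)%N.
Proof.
case: n => [//|n']; rewrite /Q2; move: n'.+1 => n.
case: ifP => [no|ne].
  apply/eqP; rewrite cards_eq0; apply/eqP/setP => -[a b]; rewrite !inE /=.
  by apply/negP => /and4P[oa ob _ /eqP E]; rewrite -E oddD oa ob in no.
have h (i : 'I_(n %/ 4)) : (2 * i + 1 < n.+1)%N by case: i => i /=; lia.
have h' (i : 'I_(n %/ 4)) : (n - (2 * i + 1) < n.+1)%N by lia.
pose f (i : 'I_(n %/ 4)) := (Ordinal (h i), Ordinal (h' i)).
have fi : injective f by move=> i j [] E _; apply/val_inj => /=; lia.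
rewrite -[RHS]card_ord -(card_imset _ fi); apply: eq_card => -[a b].
rewrite !inE /=; apply/and4P/imsetP => [[oa ob ab /eqP E]|[i _ [-> ->]]] /=.
  have ia : (a./2 < n %/ 4)%N by lia.
  exists (Ordinal ia) => //; congr pair; apply/val_inj => /=; lia.
by have := ltn_ord i; split; lia.
Qed.

Fixpoint fibonacci (n : nat) : nat :=
  match n with
  | 0%N => 0%N
  | 1%N => 1%N
  | (n'.+1 as n1).+1 => (fibonacci n1 + fibonacci n')%N
  end.

Definition S_ (n k : nat) : int :=
  \sum_(0 <= j < k.+1)
    ('C(k, j))%:Z * (3 * (q (n%:Z - k%:Z - j%:Z))%:Z
                     - 2 * (Q1 (n%:Z - k%:Z - j%:Z))%:Z
                     - (Q2 (n%:Z - k%:Z - j%:Z))%:Z).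

Definition golden_ratio (R : realType) : R := (1 + Num.sqrt 5) / 2.

(* Main.v *)
(* Put a(n) = 3q(n) - 2Q_1(n) - Q_2(n). Subtracting x^4/((1-x^2)(1-x^4)) from
   the left-hand side gives the generating function of a, and S_{n,k} is the
   coefficient of x^n in its product with (x + x^2)^k, while x/(1-x-x^2)
   generates the Fibonacci numbers. So the claim says that the sum of
   (F_n - S_{n,k}) x^n over n > 2k is positive. For n >= 2k, F_n - S_{n,k} is
   the sum over j of C(k,j) (F_m - a(m)) with m = n - k - j, so it suffices
   that a(m) <= F_m for m >= 1, strictly for m >= 8. This holds because
   q(m) <= q(m-1) + q(m-2) and 3q(8) < F_8, 3q(9) < F_9, the remaining m being
   checked one by one. *)

Require Import Defs.
From HB Require Import structures.
From mathcomp Require Import all_boot all_order all_algebra zify ring lra.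
From mathcomp Require Import all_classical all_reals all_analysis.

Set Implicit Arguments.
Unset Strict Implicit.
Unset Printing Implicit Defensive.

Import Order.TTheory GRing.Theory Num.Theory.
Import numFieldNormedType.Exports.

Local Open Scope ring_scope.

(** * Partitions into odd parts below a bound *)

Fixpoint odd_part_count_fuel (f N n : nat) : nat :=
  match N, f with
  | 0%N, _ => (n == 0)%N
  | N'.+1, 0%N => 0%N
  | N'.+1, f'.+1 =>
      (odd_part_count_fuel f' N' n +
       if odd N' && (N' <= n)%N then odd_part_count_fuel f' N'.+1 (n - N') else 0)%N
  end.

(* The number of partitions of n into odd parts smaller than N; each
   recursive call decreases N + n, so this much fuel is enough. *)
Definition odd_part_count (N n : nat) : nat := odd_part_count_fuel (N + n) N n.

Lemma odd_part_count_fuelE (f N n : nat) : (N + n <= f)%N ->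
  odd_part_count_fuel f N n = odd_part_count N n.
Proof.
move=> Nnf; suff H g : (N + n <= g)%N ->
  odd_part_count_fuel f N n = odd_part_count_fuel g N n by exact: H.
elim: f g N n Nnf => [|f IH] [|g] [|N] n //= nf ng.
congr (_ + _)%N; first by apply: IH; lia.
by case: ifP => // /andP[]; case: N nf ng => //= N nf ng oN Nn; apply: IH; lia.
Qed.

Lemma odd_part_count0 (n : nat) : odd_part_count 0 n = (n == 0)%N.
Proof. by rewrite /odd_part_count; case: (0 + n)%N. Qed.

Lemma odd_part_countS (N n : nat) : odd_part_count N.+1 n =
  (odd_part_count N n +
   if odd N && (N <= n)%N then odd_part_count N.+1 (n - N) else 0)%N.
Proof.
rewrite {1}/odd_part_count addSn /= odd_part_count_fuelE //; congr addn.
case: ifP => // /andP[oN Nn]; apply: odd_part_count_fuelE.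
by move: oN Nn; case: N => //=; lia.
Qed.

(** A part exceeding [n] cannot occur, so raising the bound past [n.+1] adds nothing. *)
Lemma odd_part_count_large (N n : nat) : (n < N)%N ->
  odd_part_count N n = odd_part_count n.+1 n.
Proof.
elim: N => // N IH; rewrite ltnS leq_eqVlt => /predU1P[->//|nN].
by rewrite odd_part_countS IH // (leqNgt N) nN andbF addn0.
Qed.

Lemma leq_odd_part_count (N n : nat) :
  (odd_part_count N n <= odd_part_count n.+1 n)%N.
Proof.
have [/odd_part_count_large ->//|/leqW] := ltnP n N.
suff: {homo odd_part_count^~ n : a b / (a <= b)%N} by exact.
by apply: homo_leq => [//|? ? ?|i]; [exact: leq_trans|rewrite odd_part_countS leq_addr].
Qed.

Lemma odd_part_count_at0 (N : nat) : odd_part_count N 0 = 1%N.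
Proof.
elim: N => [|N IH]; first by rewrite odd_part_count0.
by rewrite odd_part_countS IH; case: N {IH} => //= N; rewrite andbF.
Qed.

Lemma odd_part_count2 (n : nat) : odd_part_count 2 n = 1%N.
Proof.
elim: n => [|n IH]; first exact: odd_part_count_at0.
by rewrite odd_part_countS /= subn1 /= IH odd_part_countS /= odd_part_count0.
Qed.

(* The induction needs the strict inequality beyond N: allowing the part N
   costs one unit exactly at n + 2 = N. *)
Lemma odd_part_count_fib (N n : nat) : (1 < N)%N ->
  (odd_part_count N n.+2 + (N <= n.+2) <=
   odd_part_count N n.+1 + odd_part_count N n)%N.
Proof.
elim: N n => // N IH n; rewrite ltnS leq_eqVlt => /predU1P[<-|N1].
  by rewrite !odd_part_count2.
have IHN m := IH m N1; case oN : (odd N); last first.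
  rewrite (odd_part_countS N n.+2) (odd_part_countS N n.+1) (odd_part_countS N n) oN /= !addn0.
  apply: leq_trans (IHN n); rewrite leq_add2l.
  by case: (ltnP N n.+2) => // /ltnW ->.
(* For odd [N] the new part can be removed, which calls for a second induction, on [n]. *)
elim/ltn_ind: n => n IHn.
rewrite (odd_part_countS N n.+2) (odd_part_countS N n.+1) (odd_part_countS N n) oN /=.
have := IHN n.
have [nN|nN] := ltnP n.+2 N.
  have [-> -> ->] : [/\ N <= n.+1 = false, N <= n = false
    & N < n.+2 = false]%N by split; lia.
  lia.
(* The partition consisting of [N] alone is new; it uses up the strictness of [IHN]. *)
have [->|nN2] := eqVneq n.+2 N.
  by rewrite subnn odd_part_count_at0; lia.
have [E|nN3] := eqVneq n.+1 N.
  rewrite -{}E in IHN oN N1 IHn *.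
  rewrite subnn subSnn !leqnn odd_part_count_at0 ltnn.
  rewrite (_ : odd_part_count n.+2 1 = 1)%N; last first.
    by rewrite odd_part_count_large // odd_part_count2.
  lia.
have nN4 : (N <= n)%N by lia.
have nN5 : (n - N < n)%N by lia.
have N2 : (N < n.+2)%N by lia.
(* [N] fits into all three arguments: add [IHN] at [n] and the inner hypothesis at [n - N]. *)
have := IHn _ nN5; rewrite nN4 (leqW nN4) N2 (subSn (leqW nN4)) (subSn nN4).
lia.
Qed.

(** * The generating polynomial of partitions into odd parts *)

(** The exponent [j] is the multiplicity of the part [i]. An even [i] admits only [j = 0], giving
    the factor 1; truncating at [M] does not affect degrees below [M]. *)
Lemma coef_prod_odd_geometric (M N n : nat) : (n < M)%N ->
  (\prod_(i < N) \sum_(j < M)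
     (if (0 < j)%N ==> odd i then 'X^(i * j) else 0 : {poly int}))`_n
  = (odd_part_count N n)%:R.
Proof.
elim: N n => [|N IH] n nM.
  by rewrite big_ord0 odd_part_count0 coef1.
rewrite big_ord_recr /=.
set P := (X in X * _); set G := (X in _ * X).
case oN : (odd N); last first.
  have -> : G = 1.
    rewrite /G; case: M nM {G P IH} => // M _; rewrite big_ord_recl /= muln0.
    by rewrite big1 ?addr0 // => i _; rewrite /= oN.
  by rewrite mulr1 IH // odd_part_countS oN addn0.
(* The finite geometric sum, in a form whose coefficients mirror [odd_part_countS]. *)
have GE : G = 1 + 'X^N * G - 'X^(N * M).
  rewrite /G; under eq_bigr do rewrite oN implybT.
  have := @big_ord_recr {poly int} 0 +%R M (fun j : 'I_M.+1 => 'X^(N * j)).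
  rewrite big_ord_recl muln0 expr0 /= => E; apply/eqP; rewrite eq_sym subr_eq -E.
  apply/eqP; congr (_ + _); rewrite mulr_sumr; apply: eq_bigr => j _.
  by rewrite -exprD -mulnS.
have N0 : (0 < N)%N by case: (N) oN.
have PG : P * G = P + 'X^N * (P * G) - 'X^(N * M) * P by rewrite {1}GE; ring.
elim/ltn_ind: n nM => n IHn nM.
rewrite PG !coefD coefN coefXnM coefXnM IH // odd_part_countS oN /=.
have -> : (n < N * M)%N by nia.
rewrite subr0 natrD; congr (_ + _); rewrite (leqNgt N).
case: ltnP => //= Nn; rewrite IHn //; lia.
Qed.

(** Distributing the product yields one monomial per multiplicity function, of degree the
    partitioned number, or 0 if an even part is used. *)
Lemma q_odd_part_count (n : nat) : q n = odd_part_count n.+1 n.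
Proof.
have := @coef_prod_odd_geometric n.+1 n.+1 n (ltnSn n).
rewrite bigA_distr_bigA coef_sum => H.
apply/eqP; rewrite -(eqr_nat int) -{}H /q -sum1_card natr_sum.
rewrite big_mkcond /=; apply/eqP; apply: eq_bigr => f _; rewrite inE.
case: forallP => [fo|/forallP].
  rewrite (eq_bigr (fun i : 'I_n.+1 => 'X^(i * f i))); last by move=> i _; rewrite fo.
  by rewrite -expr_sum coefXn eq_sym; case: eqP.
rewrite negb_forall => /existsP[i fi].
by rewrite /= (bigD1 i) //= (negbTE fi) mul0r coef0.
Qed.

(** * Comparison with the Fibonacci numbers *)

Lemma leq_q_fib (n : nat) : (q n.+2 <= q n.+1 + q n)%N.
Proof.
rewrite !q_odd_part_count.
rewrite -(@odd_part_count_large n.+3 n.+1) // -(@odd_part_count_large n.+3 n); last by lia.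
by apply: leq_trans (@odd_part_count_fib n.+3 n isT); rewrite leq_addr.
Qed.

Lemma Q1_count (n : nat) :
  Q1 n.+1 = count (fun d => odd d && (d %| n.+1)%N) (iota 0 n.+2).
Proof.
rewrite [LHS]cardE /enum_mem size_filter -enumT -val_enum_ord count_map.
by apply: eq_count => d; rewrite /= inE.
Qed.

(** The threshold 8 is sharp: $3q(7)=15$ exceeds $F_7=13$. Two consecutive cases are carried through
    the induction. *)
Lemma ltn_q_fibonacci (n : nat) : (8 <= n)%N -> (3 * q n < fibonacci n)%N.
Proof.
have H m : (3 * q m.+4.+4 < fibonacci m.+4.+4)%N /\
           (3 * q m.+4.+4.+1 < fibonacci m.+4.+4.+1)%N.
  elim: m => [|m [IH1 IH2]]; first by rewrite !q_odd_part_count.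
  split=> //; have := leq_q_fib m.+4.+4.
  rewrite -[fibonacci _]/(fibonacci m.+4.+4.+1 + fibonacci m.+4.+4)%N; lia.
move=> n8; have [m ->] : exists m, n = m.+4.+4 by exists (n - 8)%N; lia.
by have [] := H m.
Qed.

Lemma leq_q_fibonacci_Q (n : nat) : (0 < n)%N ->
  (3 * q n <= fibonacci n + 2 * Q1 n + Q2 n)%N.
Proof.
have [n8 _|] := ltnP 7 n; first by have := ltn_q_fibonacci n8; lia.
by do 8?[case: n => [|n] //]; rewrite Q2E Q1_count q_odd_part_count.
Qed.

(** * Recurrences and signs of $F_n-S_{n,k}$ *)

(* S_ with its first argument extended to the integers, which spares the
   recurrence in k any boundary case. *)
Definition S_coef (z : int) : int :=
  3 * (q z)%:Z - 2 * (Q1 z)%:Z - (Q2 z)%:Z.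

Definition S_int (z : int) (k : nat) : int :=
  \sum_(0 <= j < k.+1) ('C(k, j))%:Z * S_coef (z - k%:Z - j%:Z).

(** Pascal's rule; on generating functions this is multiplication by $x+x^2$. *)
Lemma S_int_rec (z : int) (k : nat) :
  S_int z k.+1 = S_int (z - 1) k + S_int (z - 2) k.
Proof.
rewrite /S_int big_nat_recl // bin0.
under eq_bigr do rewrite binS PoszD mulrDl.
rewrite big_split /= addrA; congr (_ + _).
  rewrite big_nat_recr //= bin_small // mul0r [in RHS]big_nat_recl // bin0.
  congr (_ + _); first by congr (_ * S_coef _); lia.
  by rewrite addr0; apply: eq_bigr => i _; congr (_ * S_coef _); lia.
by apply: eq_bigr => i _; congr (_ * S_coef _); lia.
Qed.

Lemma S_int_lt0 (z : int) (k : nat) : z < 0 -> S_int z k = 0.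
Proof.
move=> z0; rewrite /S_int big1 // => j _.
by case E : (z - k%:Z - j%:Z) => [m|m]; [lia | rewrite mulr0].
Qed.

Definition fib_gap (n k : nat) : int := (fibonacci n)%:Z - S_ n k.

Lemma fib_gapE (n : nat) :
  fib_gap n 0 = (fibonacci n)%:Z - 3 * (q n)%:Z + 2 * (Q1 n)%:Z + (Q2 n)%:Z.
Proof. by rewrite /fib_gap /S_ big_nat1 bin0 !subr0; ring. Qed.

Lemma fib_gapSS (n k : nat) : fib_gap n.+2 k.+1 = fib_gap n.+1 k + fib_gap n k.
Proof.
rewrite /fib_gap -[S_ n.+2 _]/(S_int n.+2 k.+1) S_int_rec.
rewrite (_ : n.+2%:Z - 1 = n.+1%:Z); last by lia.
rewrite (_ : n.+2%:Z - 2 = n%:Z); last by lia.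
by rewrite -[fibonacci n.+2]/(fibonacci n.+1 + fibonacci n)%N PoszD /S_int /S_ /S_coef; ring.
Qed.

Lemma fib_gap0S (k : nat) : fib_gap 0 k.+1 = 0.
Proof. by rewrite /fib_gap -[S_ _ _]/(S_int 0 k.+1) S_int_rec !S_int_lt0. Qed.

(** The extra 1 is the seed $F_1$, which the Fibonacci recurrence does not produce from $F_0$. *)
Lemma fib_gap1S (k : nat) : fib_gap 1 k.+1 = 1 + fib_gap 0 k.
Proof.
by rewrite /fib_gap -[S_ _ _]/(S_int 1 k.+1) S_int_rec [S_int (1 - 2) _]S_int_lt0 // addr0 add0r.
Qed.

(** [fib_gapSS] lowers [n] by at most 2 and [k] by 1, so $2k<n$ persists down to [k = 0]. *)
Lemma fib_gap_ge0 (n k : nat) : (2 * k < n)%N -> 0 <= fib_gap n k.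
Proof.
elim: k n => [|k IH] n kn; first by rewrite fib_gapE; have := @leq_q_fibonacci_Q n; lia.
by case: n kn => [|[|n]] kn; try lia; rewrite fib_gapSS addr_ge0 // IH //; lia.
Qed.

Lemma fib_gap_gt0 (n k : nat) : (2 * k + 8 <= n)%N -> 0 < fib_gap n k.
Proof.
elim: k n => [|k IH] n kn; first by rewrite fib_gapE; have := @ltn_q_fibonacci n; lia.
by case: n kn => [|[|n]] kn; try lia; rewrite fib_gapSS addr_gt0 // IH //; lia.
Qed.

(** * Bounds for the infinite product and the series *)

Lemma is_cvg_limn_le (R : realType) (u : nat -> R) (K : R) :
  (forall n, u n <= u n.+1) -> (forall n, u n <= K) ->
  [/\ cvgn u, limn u <= K & forall n, u n <= limn u].
Proof.
move=> u_nd uK; have nd : {homo u : n m / (n <= m)%N >-> n <= m}.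
  by apply: homo_leq => // ? ? ?; exact: le_trans.
have cu : cvgn u by apply: nondecreasing_is_cvgn => //; exists K => _ [n _ <-].
split=> //; last by move=> n; exact: nondecreasing_cvgn_le.
by apply: limr_le => //; exact: nearW.
Qed.

(** Sorting partitions by whether they use the part [N] gives $U+x^NT=T$ for the full series, that
    is $U=(1-x^N)T$. *)
Lemma odd_part_count_gf_le (R : realType) (x K : R) (N L : nat) :
  0 < x -> x < 1 -> odd N ->
  (forall M, \sum_(0 <= n < M) (odd_part_count N.+1 n)%:R * x ^+ n <= K) ->
  \sum_(0 <= n < L) (odd_part_count N n)%:R * x ^+ n <= (1 - x ^+ N) * K.
Proof.
move=> x0 x1 oN TK.
set T := fun M => \sum_(0 <= n < M) (odd_part_count N.+1 n)%:R * x ^+ n.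
set U := fun M => \sum_(0 <= n < M) (odd_part_count N n)%:R * x ^+ n.
have xn0 n : 0 <= x ^+ n by rewrite exprn_ge0 // ltW.
have t0 c n : 0 <= c%:R * x ^+ n by rewrite mulr_ge0.
have T_nd M : T M <= T M.+1 by rewrite /T big_nat_recr //= lerDl.
have U_nd : {homo U : n m / (n <= m)%N >-> n <= m}.
  apply: homo_leq => [//|? ? ?|M]; first exact: le_trans.
  by rewrite /U big_nat_recr //= lerDl.
have [_ limK Tlim] := is_cvg_limn_le T_nd TK.
have TU M : U (M + N)%N + x ^+ N * T M = T (M + N)%N.
  rewrite /T /U [RHS](eq_bigr (fun n => (odd_part_count N n)%:R * x ^+ n +
    if (N <= n)%N then (odd_part_count N.+1 (n - N))%:R * x ^+ n else 0)); last first.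
    move=> n _; rewrite odd_part_countS oN /= natrD mulrDl; congr (_ + _).
    by case: ifP; rewrite ?mul0r.
  rewrite big_split /=; congr (_ + _).
  rewrite [RHS](@big_cat_nat _ _ _ N) //= ?leq_addl //.
  rewrite [X in _ = X + _]big1_seq ?add0r => [|i]; last first.
    by rewrite mem_index_iota /= => iN; rewrite leqNgt iN.
  rewrite -[X in index_iota X (M + N)]add0n big_addn addnK mulr_sumr; apply: eq_bigr => i _.
  by rewrite leq_addl addnK exprD; ring.
have UT M : U L + x ^+ N * T M <= limn T.
  apply: le_trans (Tlim (maxn L M + N)%N); rewrite -TU lerD //.
    by apply: U_nd; lia.
  rewrite ler_wpM2l //; suff: {homo T : n m / (n <= m)%N >-> n <= m} by apply; lia.
  by apply: homo_leq => // ? ? ?; exact: le_trans.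
have lim0 : 0 <= limn T by apply: le_trans (Tlim 0%N); rewrite /T big_geq.
have xN0 : 0 < x ^+ N by rewrite exprn_gt0.
(* [UT] holds for every [M], so it can be solved for [T] and passed to the limit. *)
have TlimN n : T n <= (limn T - U L) / x ^+ N.
  by rewrite ler_pdivlMr // mulrC; have := UT n; lra.
have [_ + _] := is_cvg_limn_le T_nd TlimN.
rewrite ler_pdivlMr // => H.
have {}H : U L <= (1 - x ^+ N) * limn T by lra.
by apply: le_trans H _; rewrite ler_wpM2l // subr_ge0 exprn_ile1 // ltW.
Qed.

(** Removing the possible parts one at a time ends at [N = 0], where the series is 1. *)
Lemma odd_part_count_gf_ge (R : realType) (x K : R) (N : nat) :
  0 < x -> x < 1 ->
  (forall M, \sum_(0 <= n < M) (odd_part_count N n)%:R * x ^+ n <= K) ->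
  1 <= (\prod_(0 <= i < N) (if odd i then 1 - x ^+ i else 1)) * K.
Proof.
move=> x0 x1; elim: N K => [|N IH] K TK.
  by have := TK 1%N; rewrite big_nat1 big_geq // odd_part_count0 expr0 !mul1r.
rewrite big_nat_recr //= -mulrA; apply: IH => L.
case oN : (odd N); first exact: odd_part_count_gf_le.
rewrite mul1r; under eq_bigr do rewrite -[odd_part_count N _]addn0.
by apply: le_trans (TK L); under [leRHS]eq_bigr do rewrite odd_part_countS oN.
Qed.

(* (1 + x^i)(1 - x^i) = 1 - x^(2i), so the odd factors cancel and the even
   ones only improve the bound. *)
Lemma prod_distinct_odd_le1 (R : realType) (x : R) (N : nat) :
  0 < x -> x < 1 ->
  (\prod_(1 <= i < N) (1 + x ^+ i)) *
  (\prod_(0 <= i < N) (if odd i then 1 - x ^+ i else 1)) <= 1.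
Proof.
move=> x0 x1; case: N => [|N]; first by rewrite !big_geq // mulr1.
pose e i := if odd i then 1 else 1 - x ^+ i.
have xi i : (0 < i)%N -> 0 < 1 - x ^+ i.
  by move=> i0; rewrite subr_gt0 exprn_ilt1 ?ltW // -lt0n.
have xi1 i : 1 - x ^+ i <= 1 by rewrite gerBl exprn_ge0 // ltW.
have e_gt0 i : (0 < i)%N -> 0 < e i by move=> i0; rewrite /e; case: ifP => // _; exact: xi.
have e_le1 i : e i <= 1 by rewrite /e; case: ifP.
pose E M := \prod_(1 <= i < M.+1) e i.
have E_gt0 M : 0 < E M.
  by rewrite /E big_nat; apply: prodr_gt0 => i /andP[i0 _]; exact: e_gt0.
have E2 M : E (2 * M)%N = \prod_(1 <= i < M.+1) (1 - x ^+ (2 * i)).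
  elim: M => [|M IH]; first by rewrite /E !big_geq.
  rewrite [RHS]big_nat_recr //= -IH /E mulnS !addSn add0n.
  rewrite big_nat_recr //= big_nat_recr //= -mulrA; congr (_ * _).
  by rewrite /e /= oddM /= mul1r.
have EN j : E (j + N)%N <= E N.
  elim: j => [//|j IH]; apply: le_trans IH; rewrite addSn /E big_nat_recr //=.
  by rewrite ler_piMr // ltW // -/(E _) E_gt0.
(* After multiplying by [E N] the left side is exactly $\prod(1-x^{2i})$, which is [E (2 * N)]. *)
rewrite -(ler_pM2r (E_gt0 N)) /= mul1r; apply: le_trans (EN N); rewrite addnn -mul2n E2 /E.
rewrite [X in _ * X * _]big_ltn //= mul1r -!big_split /=.
rewrite (eq_bigr (fun i => 1 - x ^+ (2 * i))) // => i _.
by rewrite mulnC exprM /e; case: ifP => _; ring.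
Qed.

(** One half of Euler's theorem on distinct and odd parts, as an inequality between series. *)
Lemma prod_distinct_le (R : realType) (x K : R) :
  0 < x -> x < 1 -> (forall L, \sum_(0 <= n < L) (q n)%:R * x ^+ n <= K) ->
  \big[*%R/1]_(1 <= n <oo) (1 + x ^+ n) <= K.
Proof.
move=> x0 x1 qK; have xn0 n : 0 <= x ^+ n by rewrite exprn_ge0 // ltW.
pose P N := \prod_(1 <= n < N) (1 + x ^+ n).
have P_ge0 N : 0 <= P N by apply: prodr_ge0 => i _; rewrite addr_ge0.
have K0 : 0 <= K by have := qK 0%N; rewrite big_geq.
have PK N : P N <= K.
  have := @odd_part_count_gf_ge R x K N x0 x1.
  set O := \prod_(0 <= i < N) _ => /(_ _) OK.
  have {}OK : 1 <= O * K.
    apply: OK => M; apply: le_trans (qK M); apply: ler_sum => n _.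
    by rewrite ler_wpM2r // ler_nat q_odd_part_count leq_odd_part_count.
  have := prod_distinct_odd_le1 N x0 x1; rewrite -/O -/(P N) => PO.
  apply: le_trans (_ : P N * (O * K) <= K).
    by rewrite ler_peMr.
  by rewrite mulrA ler_piMl.
suff [] : [/\ cvgn P, limn P <= K & forall n, P n <= limn P] by [].
apply: is_cvg_limn_le => // -[|n]; first by rewrite /P !big_geq.
by rewrite {2}/P big_nat_recr //= -/(P _) ler_peMr // lerDl.
Qed.

(** Each odd divisor [c] of [n] gives a factorisation [c * d], with both factors below [L]. *)
Lemma leq_Q1_sum (n L : nat) : (n < L)%N ->
  (Q1 n <= \sum_(1 <= d < L) \sum_(0 <= c < L) (odd c && (c * d == n)))%N.
Proof.
case: n => [//|n] nL; rewrite Q1_count -sum1_count big_mkcond.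
rewrite -[iota 0 n.+2]/(index_iota 0 n.+2) exchange_big [leqRHS](@big_cat_nat _ _ _ n.+2) //=.
rewrite -[leqLHS]addn0 leq_add //; apply: leq_sum => c _.
case: ifP => // /andP[oc /dvdnP[d E]].
have d0 : (0 < d)%N by case: (d) E.
have c0 : (0 < c)%N by case: (c) oc.
rewrite (bigD1_seq d) ?iota_uniq //= ?oc; first by rewrite E mulnC eqxx.
by rewrite mem_index_iota d0 /=; nia.
Qed.

Lemma sum_odd_exp_le (R : realType) (y : R) (L : nat) : 0 <= y -> y < 1 ->
  \sum_(0 <= c < L) (odd c)%:R * y ^+ c <= y / (1 - y ^+ 2).
Proof.
move=> y0 y1; have y2 : 0 < 1 - y ^+ 2 by rewrite subr_gt0 exprn_ilt1.
have H M : \sum_(0 <= c < 2 * M) (odd c)%:R * y ^+ c = y * (1 - y ^+ (2 * M)) / (1 - y ^+ 2).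
  elim: M => [|M IH]; first by rewrite big_geq // expr0 subrr mulr0 mul0r.
  rewrite mulnS !addSn add0n big_nat_recr //= big_nat_recr //= IH oddM /=.
  by rewrite !exprS; field; rewrite gt_eqF.
(* Lengthening the sum to even length makes the closed form [H] available. *)
apply: le_trans (_ : \sum_(0 <= c < 2 * L) (odd c)%:R * y ^+ c <= _).
  rewrite [leRHS](@big_cat_nat _ _ _ L) //=; last by lia.
  by rewrite lerDl sumr_ge0 // => i _; rewrite mulr_ge0 // exprn_ge0.
rewrite H ler_wpM2r ?invr_ge0 ?(ltW y2) // ler_piMr //.
by rewrite gerBl exprn_ge0.
Qed.

Lemma Q1_gf_le (R : realType) (x : R) (L : nat) : 0 < x -> x < 1 ->
  \sum_(0 <= n < L) (Q1 n)%:R * x ^+ n <=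
  \big[+%R/0]_(1 <= n <oo) (x ^+ n / (1 - x ^+ (2 * n))).
Proof.
move=> x0 x1; have xn0 n : 0 <= x ^+ n by rewrite exprn_ge0 // ltW.
have xi i : (0 < i)%N -> 0 < 1 - x ^+ i.
  by move=> i0; rewrite subr_gt0 exprn_ilt1 ?ltW // -lt0n.
have x1_gt0 : 0 < 1 - x by rewrite subr_gt0.
pose B N := \sum_(1 <= n < N) (x ^+ n / (1 - x ^+ (2 * n))).
have B_nd N : B N <= B N.+1.
  case: N => [|N]; first by rewrite /B !big_geq.
  rewrite /B [leRHS]big_nat_recr //= lerDl divr_ge0 // ltW // xi //; lia.
(* A crude bound from $1-x^{2n}\ge 1-x$, used only for convergence. *)
have BK N : B N <= 1 / (1 - x) / (1 - x).
  apply: le_trans (_ : \sum_(0 <= n < N) x ^+ n / (1 - x) <= _).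
    case: N => [|N]; first by rewrite /B !big_geq.
    rewrite [leRHS]big_ltn //=; apply: ler_wpDl; first by rewrite divr_ge0 // ltW.
    apply: ler_sum_nat => i /andP[i0 _]; rewrite ler_wpM2l //.
    rewrite lef_pV2 ?posrE ?xi ?muln_gt0 // lerB //.
    by rewrite -[leRHS]expr1 ler_wiXn2l ?ltW // muln_gt0.
  rewrite -mulr_suml ler_wpM2r ?invr_ge0 ?(ltW x1_gt0) //.
  have xx : `|x| < 1 by rewrite ger0_norm // ltW.
  have H := @geometric_le_lim R N 1 x ler01 x0 xx.
  by under eq_bigr do rewrite -[x ^+ _]mul1r; exact: H.
have [_ _ Blim] := is_cvg_limn_le B_nd BK.
apply: le_trans (Blim L).
(* Expand the Lambert series as $\sum x^{cd}$ over odd [c], truncated to the square [c, d < L]. *)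
apply: le_trans (_ : \sum_(1 <= d < L) \sum_(0 <= c < L) (odd c)%:R * (x ^+ d) ^+ c <= _).
  apply: le_trans (_ : \sum_(0 <= n < L) \sum_(1 <= d < L) \sum_(0 <= c < L)
    (odd c && (c * d == n))%:R * x ^+ n <= _).
    apply: ler_sum_nat => n /andP[_ nL].
    under eq_bigr do rewrite -mulr_suml.
    rewrite -mulr_suml ler_wpM2r //; under eq_bigr do rewrite -natr_sum.
    by rewrite -natr_sum ler_nat leq_Q1_sum.
  rewrite exchange_big /=; apply: ler_sum => d _.
  rewrite exchange_big /=; apply: ler_sum => c _.
  rewrite -exprM mulnC; case: (odd c) => /=; last first.
    by rewrite mul0r; rewrite big1 // => n _; rewrite mul0r.
  rewrite mul1r; have [cdL|cdL] := ltnP (c * d) L.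
    rewrite (bigD1_seq (c * d)%N) ?iota_uniq ?mem_index_iota //= eqxx mul1r.
    by rewrite big1 ?addr0 // => n; rewrite eq_sym => /negbTE ->; rewrite mul0r.
  rewrite big1_seq // => n; rewrite mem_index_iota /= => nL.
  by rewrite gtn_eqF ?mul0r //; apply: leq_trans nL cdL.
apply: ler_sum_nat => d /andP[d0 _].
rewrite [in leRHS]mulnC exprM; apply: sum_odd_exp_le => //.
by rewrite exprn_ilt1 ?ltW // -lt0n.
Qed.

Lemma Q2_gf_le (R : realType) (x : R) (L : nat) : 0 < x -> x < 1 ->
  \sum_(0 <= n < L) (Q2 n)%:R * x ^+ n <= x ^+ 4 / ((1 - x ^+ 2) * (1 - x ^+ 4)).
Proof.
move=> x0 x1; have xn0 n : 0 <= x ^+ n by rewrite exprn_ge0 // ltW.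
have x2 : 0 < 1 - x ^+ 2 by rewrite subr_gt0 exprn_ilt1 // ltW.
have x4 : 0 < 1 - x ^+ 4 by rewrite subr_gt0 exprn_ilt1 // ltW.
(* The subtracted term is the tail $(1+x^2)\sum_{m\ge M}m x^{4m}$, since $Q_2(4m)=Q_2(4m+2)=m$. *)
have H M : \sum_(0 <= n < 4 * M) (Q2 n)%:R * x ^+ n =
    x ^+ 4 / ((1 - x ^+ 2) * (1 - x ^+ 4)) -
    (1 + x ^+ 2) * x ^+ (4 * M) * (M%:R / (1 - x ^+ 4) + x ^+ 4 / (1 - x ^+ 4) ^+ 2).
  elim: M => [|M IH].
    rewrite big_geq // expr0; field.
    by rewrite !gt_eqF.
  rewrite mulnS !addSn add0n 4?big_nat_recr // IH !Q2E.
  have [-> -> -> ->] : [/\ odd (4 * M) = false, odd (4 * M).+1, odd (4 * M).+2 = false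
    & odd (4 * M).+3] by split; lia.
  have [-> ->] : (4 * M %/ 4 = M)%N /\ ((4 * M).+2 %/ 4 = M)%N by split; lia.
  rewrite /= -natr1 !exprS; field.
  by rewrite !gt_eqF.
apply: le_trans (_ : \sum_(0 <= n < 4 * L) (Q2 n)%:R * x ^+ n <= _).
  rewrite [leRHS](@big_cat_nat _ _ _ L) //=; last by lia.
  by rewrite lerDl sumr_ge0 // => i _; rewrite mulr_ge0.
by rewrite H gerBl !mulr_ge0 ?addr_ge0 ?divr_ge0 // ?exprn_ge0 // ltW.
Qed.

Lemma fibonacci_gf_le (R : realType) (x : R) (L : nat) :
  0 < x -> 0 < 1 - x - x ^+ 2 ->
  \sum_(0 <= n < L) (fibonacci n)%:R * x ^+ n <= x / (1 - x - x ^+ 2).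
Proof.
move=> x0 d0; have xn0 n : 0 <= x ^+ n by rewrite exprn_ge0 // ltW.
(* Multiplication by $1-x-x^2$ telescopes, leaving two nonpositive end terms. *)
have H M : (\sum_(0 <= n < M.+1) (fibonacci n)%:R * x ^+ n) * (1 - x - x ^+ 2) =
    x - (fibonacci M.+1)%:R * x ^+ M.+1 - (fibonacci M)%:R * x ^+ M.+2.
  elim: M => [|M IH]; first by rewrite big_nat1 /=; ring.
  rewrite big_nat_recr // mulrDl IH.
  by rewrite -[fibonacci M.+2]/(fibonacci M.+1 + fibonacci M)%N natrD !exprS; ring.
case: L => [|L]; first by rewrite big_geq // divr_ge0 // ltW.
by rewrite ler_pdivlMr // H -addrA gerDl -opprD oppr_le0 addr_ge0 // mulr_ge0.
Qed.

(** $\varphi-1$ is the positive root of $1-x-x^2$. *)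
Lemma quadratic_gt0_of_lt_golden_ratio (R : realType) (x : R) :
  0 < x -> x < golden_ratio R - 1 -> 0 < 1 - x - x ^+ 2.
Proof.
rewrite /golden_ratio => x0 xg.
have s5 : Num.sqrt 5 ^+ 2 = 5 :> R by rewrite sqr_sqrtr.
have s0 : 0 <= Num.sqrt 5 :> R by exact: sqrtr_ge0.
move: xg s5 s0; set s := Num.sqrt 5 => xg s5 s0; nra.
Qed.

(** * Partial sums of the series of gaps *)

Lemma sum_fib_gap_mono (R : realType) (x : R) (k L M : nat) : 0 < x ->
  (2 * k < L)%N -> (L <= M)%N ->
  \sum_(0 <= n < L) (fib_gap n k)%:~R * x ^+ n <=
  \sum_(0 <= n < M) (fib_gap n k)%:~R * x ^+ n.
Proof.
move=> x0 kL LM; rewrite [leRHS](@big_cat_nat _ _ _ L) //= lerDl big_nat.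
apply: sumr_ge0 => n /andP[Ln _]; rewrite mulr_ge0 ?exprn_ge0 ?(ltW x0) //.
by rewrite ler0z fib_gap_ge0 // (leq_trans kL).
Qed.

(** The length [L.+1] ensures that the one negative term, $-3$ at [n = 0], is included. *)
Lemma sum_fib_gap0_le (R : realType) (x : R) (L : nat) :
  0 < x -> 0 < 1 - x - x ^+ 2 ->
  \sum_(0 <= n < L.+1) (fib_gap n 0)%:~R * x ^+ n +
  (3 * \big[*%R/1]_(1 <= n <oo) (1 + x ^+ n)
   - 2 * \big[+%R/0]_(1 <= n <oo) (x ^+ n / (1 - x ^+ (2 * n)))
   - x ^+ 4 / ((1 - x ^+ 2) * (1 - x ^+ 4))) <= x / (1 - x - x ^+ 2).
Proof.
move=> x0 d0; have x1 : x < 1 by nra.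
set D := \sum_(_ <= _ < _) _; set B := \big[+%R/0]_(1 <= n <oo) _.
set C := x ^+ 4 / _; set f := x / _.
suff : \big[*%R/1]_(1 <= n <oo) (1 + x ^+ n) <= (f + 2 * B + C - D) / 3 by lra.
apply: prod_distinct_le => // M.
(* A common length, at which the four generating functions can be compared term by term. *)
pose N := (maxn L M).+1.
have DN : D <= \sum_(0 <= n < N) (fib_gap n 0)%:~R * x ^+ n.
  by apply: sum_fib_gap_mono => //; rewrite /N; lia.
have qN : \sum_(0 <= n < M) (q n)%:R * x ^+ n <= \sum_(0 <= n < N) (q n)%:R * x ^+ n.
  rewrite [leRHS](@big_cat_nat _ _ _ M) //= ?lerDl; last by rewrite /N; lia.
  by apply: sumr_ge0 => n _; rewrite mulr_ge0 // exprn_ge0 // ltW.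
have E : \sum_(0 <= n < N) (fib_gap n 0)%:~R * x ^+ n =
    \sum_(0 <= n < N) (fibonacci n)%:R * x ^+ n
    - 3 * \sum_(0 <= n < N) (q n)%:R * x ^+ n
    + 2 * \sum_(0 <= n < N) (Q1 n)%:R * x ^+ n
    + \sum_(0 <= n < N) (Q2 n)%:R * x ^+ n.
  rewrite !mulr_sumr -sumrN -!big_split /=; apply: eq_bigr => n _.
  by rewrite fib_gapE !(rmorphD, rmorphN, rmorphM) /=; ring.
have F_le : \sum_(0 <= n < N) (fibonacci n)%:R * x ^+ n <= f by exact: fibonacci_gf_le.
have B_le : \sum_(0 <= n < N) (Q1 n)%:R * x ^+ n <= B by exact: Q1_gf_le.
have C_le : \sum_(0 <= n < N) (Q2 n)%:R * x ^+ n <= C by exact: Q2_gf_le.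
rewrite E in DN; lra.
Qed.

(** The series for [k.+1] is $x$ plus $x+x^2$ times that for [k]; the last term is the part of the
    product beyond the truncation. *)
Lemma sum_fib_gapS (R : realType) (x : R) (k M : nat) :
  \sum_(0 <= n < M.+2) (fib_gap n k.+1)%:~R * x ^+ n =
  x + (x + x ^+ 2) * (\sum_(0 <= n < M.+1) (fib_gap n k)%:~R * x ^+ n)
  - (fib_gap M k)%:~R * x ^+ M.+2.
Proof.
elim: M => [|M IH].
  rewrite big_nat_recr // !big_nat1 fib_gap0S fib_gap1S intrD mulr0z mulr1z /=; ring.
by rewrite big_nat_recr // IH fib_gapSS [in RHS]big_nat_recr // intrD /= !exprS; ring.
Qed.

(* A bound on the generating function of S_{n,0} is turned into one for
   S_{n,k} by multiplying with (x + x^2)^k, which fixes the Fibonacci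
   generating function f up to the term x: (x + x^2) f = f - x. *)
Lemma sum_fib_gap_le (R : realType) (x f G : R) (k L : nat) :
  0 < x -> (x + x ^+ 2) * f = f - x ->
  (forall M, \sum_(0 <= n < M.+1) (fib_gap n 0)%:~R * x ^+ n + G <= f) ->
  \sum_(0 <= n < (2 * k + L).+1) (fib_gap n k)%:~R * x ^+ n
    + (x + x ^+ 2) ^+ k * G <= f.
Proof.
move=> x0 fE G0; elim: k L => [|k IH] L; first by rewrite expr0 mul1r; exact: G0.
rewrite mulnS !addSn add0n sum_fib_gapS [_ ^+ k.+1]exprS.
have /(ler_wpM2l (_ : 0 <= x + x ^+ 2)) := IH L.+1.
rewrite addnS fE => /(_ _) H.
have {}H := H (ltW (addr_gt0 x0 (exprn_gt0 2 x0))).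
have : 0 <= (fib_gap (2 * k + L).+1 k)%:~R * x ^+ (2 * k + L).+3.
  by rewrite mulr_ge0 ?exprn_ge0 ?(ltW x0) // ler0z fib_gap_ge0 //; lia.
by move: H; rewrite mulrDr mulrA; lra.
Qed.

Theorem theorem8 (R : realType) (k : nat) (x : R)
    (x_gt0 : 0 < x) (x_lt : x < golden_ratio R - 1) :
  3 * \big[*%R/1]_(1 <= n <oo) (1 + x ^+ n)
    - 2 * \big[+%R/0]_(1 <= n <oo) (x ^+ n / (1 - x ^+ (2 * n)))
  < x ^+ 4 / ((1 - x ^+ 2) * (1 - x ^+ 4))
    + 1 / (x ^ (k%:Z - 1) * (1 + x) ^+ k * (1 - x - x ^+ 2))
    - 1 / (x ^+ k * (1 + x) ^+ k)
      * \sum_(0 <= n < (2 * k).+1) ((fibonacci n)%:Z - S_ n k)%:~R * x ^+ n.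
Proof.
have d_gt0 := quadratic_gt0_of_lt_golden_ratio x_gt0 x_lt.
have x_neq0 : x != 0 by rewrite gt_eqF.
have xk_gt0 : 0 < (x + x ^+ 2) ^+ k by rewrite exprn_gt0 // addr_gt0 // exprn_gt0.
have fE : (x + x ^+ 2) * (x / (1 - x - x ^+ 2)) = x / (1 - x - x ^+ 2) - x.
  by field; rewrite gt_eqF.
(* With 8 extra terms the sum reaches $n=2k+8$, where the gap is known to be positive; this makes
   the inequality strict. *)
have := @sum_fib_gap_le R x _ _ k 8 x_gt0 fE (fun M => sum_fib_gap0_le M x_gt0 d_gt0).
have gap8 : \sum_(0 <= n < (2 * k).+1) (fib_gap n k)%:~R * x ^+ n <
    \sum_(0 <= n < (2 * k + 8).+1) (fib_gap n k)%:~R * x ^+ n.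
  rewrite [ltRHS]big_nat_recr //= ltr_pwDr //; last by apply: sum_fib_gap_mono => //; lia.
  by rewrite mulr_gt0 ?exprn_gt0 // ltr0z fib_gap_gt0.
rewrite -[X in _ < _ - _ * X]/(\sum_(0 <= n < (2 * k).+1) (fib_gap n k)%:~R * x ^+ n).
have yE : x ^+ k * (1 + x) ^+ k = (x + x ^+ 2) ^+ k.
  by rewrite -exprMn mulrDr mulr1 -expr2.
rewrite expfzDr // -exprnP exprN1 [x ^+ k / x * _]mulrAC yE.
have -> : 1 / ((x + x ^+ 2) ^+ k / x * (1 - x - x ^+ 2)) =
    (x / (1 - x - x ^+ 2)) / (x + x ^+ 2) ^+ k.
  by rewrite div1r !invfM invrK [_^-1 * x]mulrC mulrAC.
move: gap8; set D := \sum_(0 <= n < (2 * k).+1) _; set D8 := \sum_(_ <= _ < _) _.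
set P := \big[*%R/1]_(1 <= n <oo) (1 + x ^+ n).
set B := \big[+%R/0]_(1 <= n <oo) (x ^+ n / (1 - x ^+ (2 * n))).
set C := x ^+ 4 / _; set f := x / _; set y := _ ^+ k => D8D le_f.
have {le_f}D8D : D + y * (3 * P - 2 * B - C) < f by lra.
rewrite -subr_gt0.
(* The difference of the two sides, multiplied by [y], is the slack in [D8D]. *)
have -> : C + f / y - 1 / y * D - (3 * P - 2 * B) = (f - (D + y * (3 * P - 2 * B - C))) / y.
  by field; rewrite gt_eqF.
by rewrite divr_gt0 // subr_gt0.
Qed.
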